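(* Let $\mathcal{M}$ be the space of total orders on $\mathbb{N}$, let $\mu$ be the Glasner-Weiss measure on $\mathcal{M}$, let $ML_\mu\subset\mathcal{M}$ be the set of $\mu$-Martin-Löf random total orders, and let $\mathcal{Q}\subset\mathcal{M}$ be the set of total orders on $\mathbb{N}$ which are isomorphic to the rational order $\eta$ (the standard ordering of the rational numbers). Then $$ML_\mu\subset\mathcal{Q}.$$ In particular, $\mu(\mathcal{Q})=1$.
   Context: $\mathcal{M}$ is the set of (strict) total orders on $\mathbb{N}$, identified with a closed subset of the compact product space $\{0,1\}^{(\mathbb{N}\times\mathbb{N})_{\neq}}$, where $(\mathbb{N}\times\mathbb{N})_{\neq}$ is the set of pairs $(i,j)$ with $i\neq j$: a total order $<$ corresponds to $\xi$ with $\xi(x,y)=1\Leftrightarrow x<y$, and one writes $<_\xi$ for the order associated with $\xi$. $S_\infty$ is the group of all permutations of $\mathbb{N}$ with the topology of pointwise convergence; it acts continuously on $\mathcal{M}$ by $x<_{\sigma\xi}y\Leftrightarrow \sigma^{-1}x<_\xi\sigma^{-1}y$. The Glasner-Weiss measure $\mu$ is the unique $S_\infty$-invariant Borel probability measure on $\mathcal{M}$ (its existence and uniqueness are known). $\mathcal{M}_f$ is the set of total orders on finite subsets of $\mathbb{N}$. For $\ell\in\mathcal{M}_f$, the cylinder set $Z_\ell$ is the set of $\xi\in\mathcal{M}$ extending $\ell$. $\mathcal{Z}$ is the algebra of subsets of $\mathcal{M}$ generated by the sets $Z_\ell$, $\ell\in\mathcal{M}_f$. For a cylinder set $Z$ write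 $Z^1=Z$ and $Z^0=\mathcal{M}\setminus Z$. A recursive representation of $\mathcal{Z}$ is an enumeration $(T_i)_{i\in\mathbb{N}}$ of $\mathcal{Z}$ such that from a given $i$ one can effectively retrieve an expression of $T_i$ as a finite union of sets of the form $Z_{\ell_1}^{\delta_1}\cap\cdots\cap Z_{\ell_k}^{\delta_k}$ with each $\ell_j\in\mathcal{M}_f$ and $\delta_j\in\{0,1\}$. A set $A\subset\mathcal{M}$ is of constructive measure $0$ if, for some recursive representation $(T_i)_{i\in\mathbb{N}}$ of $\mathcal{Z}$, there is a total recursive $\phi:\mathbb{N}^2\to\mathbb{N}$ such that $A\subset\bigcap_n\bigcup_m T_{\phi(n,m)}$ and $\mu\left(\bigcup_m T_{\phi(n,m)}\right)$ converges effectively to $0$ as $n\to\infty$ (i.e. there is a total recursive $g$ such that this measure is $<2^{-k}$ for all $n\geq g(k)$). A total order $\xi\in\mathcal{M}$ is $\mu$-Martin-Löf random if $\xi$ lies in the complement of every subset of $\mathcal{M}$ of constructive measure $0$. *)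

(* Defs.v *)
From HB Require Import structures.
From mathcomp Require Import all_boot all_order all_algebra.
From mathcomp Require Import all_classical all_reals all_analysis.

Set Implicit Arguments.
Unset Strict Implicit.
Unset Printing Implicit Defensive.

Import Order.TTheory GRing.Theory Num.Theory.

Local Open Scope classical_set_scope.

(* Total recursive functions of several variables: the least class containing
   the initial functions and closed under composition, primitive recursion and
   minimization of regular functions.  The functions built by the closure
   clauses are given by their defining equations, so the class is extensional
   by construction. *)
Inductive recursive : forall n : nat, (n.-tuple nat -> nat) -> Prop :=
| recursive_zero n : recursive (fun _ : n.-tuple nat => 0)
| recursive_succ : recursive (fun t : 1.-tuple nat => (tnth t ord0).+1)
| recursive_proj n (i : 'I_n) : recursive (fun t : n.-tuple nat => tnth t i)
| recursive_comp m n (g : m.-tuple nat -> nat) (h : 'I_m -> n.-tuple nat -> nat)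
    (f : n.-tuple nat -> nat) :
    recursive g -> (forall i, recursive (h i)) ->
    (forall t, f t = g [tuple h i t | i < m]) ->
    recursive f
| recursive_prim n (g : n.-tuple nat -> nat) (h : n.+2.-tuple nat -> nat)
    (f : n.+1.-tuple nat -> nat) :
    recursive g -> recursive h ->
    (forall t : n.-tuple nat, f [tuple of 0 :: t] = g t) ->
    (forall k (t : n.-tuple nat),
       f [tuple of k.+1 :: t] = h [tuple of k :: f [tuple of k :: t] :: t]) ->
    recursive f
| recursive_min n (g : n.+1.-tuple nat -> nat) (f : n.-tuple nat -> nat) :
    recursive g ->
    (forall t : n.-tuple nat, g [tuple of f t :: t] = 0) ->
    (forall (t : n.-tuple nat) y, g [tuple of y :: t] = 0 -> f t <= y) ->
    recursive f.

Definition recursive1 (f : nat -> nat) : Prop :=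
  recursive (fun t : 1.-tuple nat => f (tnth t ord0)).

Definition recursive2 (f : nat -> nat -> nat) : Prop :=
  recursive (fun t : 2.-tuple nat => f (tnth t ord0) (tnth t ord_max)).

Definition offdiag : Type := {p : nat * nat | p.1 != p.2}.

Definition offdiag_space : Type := prod_topology (fun _ : offdiag => bool).

HB.instance Definition _ := Topological.on offdiag_space.

(* The relation [x <_xi y]; it is false on the diagonal. *)
Definition lt_of (xi : offdiag_space) (x y : nat) : bool :=
  oapp xi false (insub (x, y)).

(* [lt_of xi] is irreflexive by construction. *)
Definition total_orders : set offdiag_space :=
  [set xi | transitive (lt_of xi) /\
            forall x y, x != y -> lt_of xi x y || lt_of xi y x].

(* The space of total orders, with the topology induced by the product. *)
Definition order_space : Type := set_type total_orders.

HB.instance Definition _ := Topological.on order_space.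

Definition ord_lt (xi : order_space) : rel nat := lt_of (set_val xi).

Definition restr_rel (r : rel nat) : offdiag_space :=
  fun p => r (val p).1 (val p).2.

Lemma lt_of_restr_rel (r : rel nat) :
  irreflexive r -> lt_of (restr_rel r) =2 r.
Proof.
move=> irr x y; rewrite /lt_of; case: insubP => [p _ e|/=].
  by rewrite /= /restr_rel e.
by rewrite negbK => /eqP ->; rewrite irr.
Qed.

Lemma restr_rel_total (r : rel nat) :
  irreflexive r -> transitive r -> (forall x y, x != y -> r x y || r y x) ->
  restr_rel r \in total_orders.
Proof.
move=> irr tr tot; apply/mem_set; split.
  by move=> y x z; rewrite !lt_of_restr_rel//; exact: tr.
by move=> x y; rewrite !lt_of_restr_rel//; exact: tot.
Qed.

Lemma nat_order_subproof : restr_rel ltn \in total_orders.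
Proof.
by apply: restr_rel_total; [exact: ltnn|exact: ltn_trans|
  move=> x y; rewrite neq_ltn].
Qed.

HB.instance Definition _ :=
  isPointed.Build order_space (exist _ (restr_rel ltn) nat_order_subproof).

(* [order_space] with its Borel sigma-algebra. *)
Definition order_borel := g_sigma_algebraType (@open order_space).

HB.instance Definition _ := Measurable.on order_borel.

Record perm_nat := PermNat {
  perm_fun : nat -> nat;
  perm_inv : nat -> nat;
  perm_funK : cancel perm_fun perm_inv;
  perm_invK : cancel perm_inv perm_fun
}.

Definition act_rel (s : perm_nat) (xi : order_space) : rel nat :=
  fun x y => ord_lt xi (perm_inv s x) (perm_inv s y).

Lemma act_subproof (s : perm_nat) (xi : order_space) :
  restr_rel (act_rel s xi) \in total_orders.
Proof.
have [tr tot] := set_valP xi.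
apply: restr_rel_total => [x|y x z|x y xy].
- by rewrite /act_rel /ord_lt /lt_of insubF//= eqxx.
- exact: tr.
- by apply: tot; rewrite (can_eq (perm_invK s)).
Qed.

(* x <_(act s xi) y iff s^-1 x <_xi s^-1 y. *)
Definition act (s : perm_nat) (xi : order_space) : order_space :=
  exist _ (restr_rel (act_rel s xi)) (act_subproof s xi).

(* The invariance characterizing the Glasner-Weiss measure. *)
Definition glasner_weiss (R : realType) (mu : probability order_borel R) : Prop :=
  forall (s : perm_nat) (A : set order_borel),
    measurable A -> mu (act s @^-1` A) = mu A.

(* A total order on a finite subset of nat, as the duplicate-free list of the
   elements of that subset in increasing order. *)
Definition fin_order : Type := {l : seq nat | uniq l}.

Definition cylinder (l : fin_order) : set order_space :=
  [set xi | pairwise (ord_lt xi) (val l)].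

Definition algebra_of_sets (T : Type) (G : set (set T)) : Prop :=
  [/\ G setT, setU_closed G & setC_closed G].

Definition cylinder_algebra : set (set order_space) :=
  smallest (@algebra_of_sets order_space) (range cylinder).

(* Formal expressions for finite unions of sets of the form
   Z_l1^d1 `&` ... `&` Z_lk^dk. *)
Definition literal : Type := (fin_order * bool)%type.
Definition expression : Type := seq (seq literal).

Definition literal_set (c : literal) : set order_space :=
  if c.2 then cylinder c.1 else ~` cylinder c.1.

Definition expression_set (e : expression) : set order_space :=
  \big[setU/set0]_(c <- e) \big[setI/setT]_(d <- c) literal_set d.

(* Goedel numbering of expressions, based on the effective bijection
   [CodeSeq.code] between lists of numbers and numbers. *)
Definition literal_code (c : literal) : nat :=
  CodeSeq.code (nat_of_bool c.2 :: val c.1).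

Definition expression_code (e : expression) : nat :=
  CodeSeq.code
    [seq CodeSeq.code [seq literal_code d | d <- c] | c <- e].

Definition recursive_representation (T : nat -> set order_space) : Prop :=
  range T = cylinder_algebra /\
  exists e : nat -> expression,
    recursive1 (fun i => expression_code (e i)) /\
    forall i, T i = expression_set (e i).

Definition constructive_null (R : realType) (mu : probability order_borel R)
    (A : set order_space) : Prop :=
  exists T : nat -> set order_space, recursive_representation T /\
  exists phi : nat -> nat -> nat, recursive2 phi /\
    A `<=` \bigcap_n \bigcup_m T (phi n m) /\
    exists g : nat -> nat, recursive1 g /\
      forall k n, g k <= n ->
        (mu (\bigcup_m T (phi n m)) < ((2^-1 : R) ^+ k)%R%:E)%E.

Definition ML_random (R : realType) (mu : probability order_borel R) :
    set order_space :=
  [set xi | forall A : set order_space, constructive_null mu A -> (~` A) xi].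

Definition rational_orders : set order_space :=
  [set xi | exists2 f : nat -> rat, bijective f &
            forall x y : nat, ord_lt xi x y = (f x < f y)%R].

(* Main.v *)
Require Import Defs.
From mathcomp Require Import all_boot all_order all_algebra.
From mathcomp Require Import all_classical all_reals all_analysis.
Local Open Scope classical_set_scope.

Set Implicit Arguments.
Unset Strict Implicit.
Unset Printing Implicit Defensive.

Import Order.TTheory GRing.Theory Num.Theory.

(** Why the theorem holds.  By Cantor's theorem ([cantor_iso]) an order on the
    natural numbers is isomorphic to the rationals as soon as it is dense without
    endpoints, that is, as soon as it has no gap: no two neighbouring points, no
    least point and no greatest point.  The possible gaps are indexed by
    countably many data: a point [b], another point or an end [p] of the order,
    and a direction ([rational_orders_gapless]).

    Fix such data and [n] points other than [p] and [b].  If there is a gap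
    between [p] and [b], then among [b] and these points it is [b] that comes
    first after [p].  The [n + 1] candidates are exchangeable under permutations
    of the natural numbers fixing [p], and they exclude each other, so invariance
    of the measure bounds the probability of this event by [1 / (n + 1)]
    ([nearest_measure]).  Hence each gap has measure zero, and since there are
    countably many of them almost every order is rational.

    The same events, for [n = 0, 1, 2, ...], are described by a recursive
    sequence of Boolean combinations of cylinders ([recursive_gap_test]) and
    their measures tend to zero with a recursive modulus.  So the orders with a
    given gap form a set of constructive measure zero
    ([gap_constructive_null]), and a random order avoids it.

    A set of constructive measure zero is defined by means of a recursive
    enumeration of the whole cylinder algebra, so the tests have to be placed in
    such an enumeration.  The binary digits of a number code a finite set of
    numbers, and three levels of this coding enumerate disjunctive normal forms
    over literals whose cylinders list their points in decreasing order; these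
    already represent every set of the algebra
    ([cylinder_algebra_nth_expression]).  Interleaving that enumeration with a
    test gives the representation needed ([recursive_representation_extend]). *)

(** * Total recursive functions *)

Lemma eq_recursive n (f g : n.-tuple nat -> nat) :
  f =1 g -> recursive f -> recursive g.
Proof. by move=> /funext ->. Qed.

Lemma recursive_app1 n (f : nat -> nat) (g : n.-tuple nat -> nat) :
  recursive1 f -> recursive g -> recursive (fun t => f (g t)).
Proof.
move=> rf rg; apply: (recursive_comp (h := fun=> g) rf) => // t.
by rewrite tnth_mktuple.
Qed.

Lemma recursive_head n : recursive (fun t : n.+1.-tuple nat => thead t).
Proof. exact: recursive_proj. Qed.

Lemma recursive_behead n (f : n.-tuple nat -> nat) :
  recursive f -> recursive (fun t : n.+1.-tuple nat => f [tuple of behead t]).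
Proof.
move=> rf.
apply: (recursive_comp
  (h := fun i (t : n.+1.-tuple nat) => tnth t (lift ord0 i)) rf) => [i|t].
  exact: recursive_proj.
congr f; apply: eq_from_tnth => i.
rewrite tnth_mktuple tnth_behead; congr tnth; apply: val_inj.
by rewrite /= inordK // ltnS.
Qed.

Lemma recursive_cst n c : recursive (fun _ : n.-tuple nat => c).
Proof.
elim: c => [|c IH]; first exact: recursive_zero.
exact: (recursive_app1 recursive_succ IH).
Qed.

(** Primitive recursion relative to the whole tuple of current variables, so that
    nested recursions can be written with ordinary lambda terms: the new
    variables (counter, value) are put in front of the parameters. *)
Lemma recursive_nat_rect n (k g : n.-tuple nat -> nat)
    (h : nat -> nat -> n.-tuple nat -> nat) :
  recursive k -> recursive g ->
  recursive (fun u : n.+2.-tuple nat =>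
    h (thead u) (thead [tuple of behead u])
      [tuple of behead [tuple of behead u]]) ->
  recursive (fun t => nat_rect (fun=> nat) (g t) (fun j r => h j r t) (k t)).
Proof.
move=> rk rg rh.
pose F (u : n.+1.-tuple nat) := let t := [tuple of behead u] in
  nat_rect (fun=> nat) (g t) (fun j r => h j r t) (thead u).
have rF : recursive F.
  have tE x (t : n.-tuple nat) : [tuple of behead [tuple of x :: t]] = t.
    exact: val_inj.
  apply: (recursive_prim rg rh) => [t|j t].
    by rewrite /F tE.
  rewrite /F /= !tE /thead !tnth0 /=; congr (h _ _ _); last exact: val_inj.
pose H (i : 'I_n.+1) : n.-tuple nat -> nat :=
  if unlift ord0 i is Some j then fun t => tnth t j else k.
apply: (recursive_comp (h := H) rF).
  move=> i; rewrite /H; case: unlift => // j; exact: recursive_proj.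
move=> t; rewrite /F.
have -> : [tuple of behead [tuple H i t | i < n.+1]] = t.
  apply: eq_from_tnth => i; rewrite tnth_behead tnth_mktuple /H.
  have -> : inord i.+1 = lift ord0 i by apply: val_inj; rewrite /= inordK // ltnS.
  by rewrite liftK.
by rewrite /thead tnth_mktuple /H unlift_none.
Qed.

Lemma recursive_S n (f : n.-tuple nat -> nat) :
  recursive f -> recursive (fun t => (f t).+1).
Proof. exact: (recursive_app1 recursive_succ). Qed.

Lemma recursive_if n (k f g : n.-tuple nat -> nat) :
  recursive k -> recursive f -> recursive g ->
  recursive (fun t => if k t == 0 then f t else g t).
Proof.
move=> rk rf rg.
have := recursive_nat_rect (h := fun _ _ => g) rk rf
  (recursive_behead (recursive_behead rg)).
by apply: eq_recursive => t; case: (k t).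
Qed.

Lemma recursive_add n (f g : n.-tuple nat -> nat) :
  recursive f -> recursive g -> recursive (fun t => f t + g t).
Proof.
move=> rf rg.
have := recursive_nat_rect (h := fun _ r _ => r.+1) rf rg
  (recursive_S (recursive_behead (recursive_head _))).
by apply: eq_recursive => t; elim: (f t) => //= a ->.
Qed.

Lemma recursive_mul n (f g : n.-tuple nat -> nat) :
  recursive f -> recursive g -> recursive (fun t => f t * g t).
Proof.
move=> rf rg.
have := recursive_nat_rect (h := fun _ r t => g t + r) rf (recursive_cst n 0)
  (recursive_add (recursive_behead (recursive_behead rg))
                 (recursive_behead (recursive_head _))).
by apply: eq_recursive => t; elim: (f t) => //= a ->; rewrite mulSn.
Qed.

Lemma recursive_double n (f : n.-tuple nat -> nat) :
  recursive f -> recursive (fun t => (f t).*2).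
Proof.
move=> rf; apply: eq_recursive (recursive_add rf rf) => t.
by rewrite addnn.
Qed.

Lemma recursive_exp2 n (f : n.-tuple nat -> nat) :
  recursive f -> recursive (fun t => 2 ^ f t).
Proof.
move=> rf.
have := recursive_nat_rect (h := fun _ r _ => r.*2) rf (recursive_cst n 1)
  (recursive_double (recursive_behead (recursive_head _))).
by apply: eq_recursive => t; elim: (f t) => //= a ->; rewrite expnS mul2n.
Qed.

Lemma recursive_odd n (f : n.-tuple nat -> nat) :
  recursive f -> recursive (fun t => odd (f t)).
Proof.
move=> rf.
have := recursive_nat_rect (h := fun _ r _ => if r == 0 then 1 else 0) rf
  (recursive_cst n 0) (recursive_if (recursive_behead (recursive_head _))
    (recursive_cst _ 1) (recursive_cst _ 0)).
by apply: eq_recursive => t; elim: (f t) => //= a ->; case: (odd a).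
Qed.

Lemma recursive_half n (f : n.-tuple nat -> nat) :
  recursive f -> recursive (fun t => (f t)./2).
Proof.
move=> rf.
have := recursive_nat_rect (h := fun j r _ => odd j + r) rf (recursive_cst n 0)
  (recursive_add (recursive_odd (recursive_head _))
     (recursive_behead (recursive_head _))).
apply: eq_recursive => t; elim: (f t) => // a /= ->.
by rewrite uphalf_half.
Qed.

(** * Codes of lists *)

(** A number stands for the finite set of the positions of its binary digits 1.
    Reading a number in this way only takes iterated halving, and every finite
    set is reached. *)
Definition bits (m : nat) : seq nat :=
  [seq k <- rev (iota 0 m) | odd (iter k half m)].

Lemma recursive_code_cons n (f : n.-tuple nat -> nat) (s : n.-tuple nat -> seq nat) :
  recursive f -> recursive (fun t => CodeSeq.code (s t)) ->
  recursive (fun t => CodeSeq.code (f t :: s t)).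
Proof.
move=> rf rs /=.
by apply: recursive_mul; [exact: recursive_exp2|exact/recursive_S/recursive_double].
Qed.

(** The bounded recursion on [k < m] conses [f k] whenever the digit [k] of [m]
    is 1; since [CodeSeq.code (n :: s)] is [2 ^ n * (CodeSeq.code s).*2.+1], no
    decoding of lists is needed. *)
Lemma recursive_code_bits f :
  recursive1 f -> recursive1 (fun m => CodeSeq.code (map f (bits m))).
Proof.
move=> rf; have rm := recursive_head 0.
have rhalf : recursive (fun u : 3.-tuple nat => odd (iter (thead u) half
    (thead [tuple of behead [tuple of behead u]]))).
  apply: recursive_odd.
  have := recursive_nat_rect (h := fun _ r _ => half r) (recursive_head 2)
    (recursive_behead (recursive_behead rm))
    (recursive_half (recursive_behead (recursive_head 3))).
  by apply: eq_recursive => t; elim: (thead t) => //= a ->.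
have := recursive_nat_rect
  (h := fun k r t => if odd (iter k half (thead t)) == 0 :> nat then r
                     else 2 ^ f k * r.*2.+1)
  rm (recursive_cst _ 0)
  (recursive_if rhalf (recursive_behead (recursive_head 1))
     (recursive_mul (recursive_exp2 (recursive_app1 rf (recursive_head 2)))
       (recursive_S (recursive_double (recursive_behead (recursive_head 1)))))).
apply: eq_recursive => t; rewrite /bits -[tnth t ord0]/(thead t).
move: (thead t) => m.
elim: {2 4}m => // a IH; rewrite [LHS]/= IH.
rewrite -[in RHS]addn1 iotaD rev_cat /= add0n.
by case: odd.
Qed.

Lemma bits_sorted m : sorted gtn (bits m).
Proof.
apply: sorted_filter; first by move=> y x z /= xy yz; exact: ltn_trans yz xy.
by rewrite rev_sorted iota_ltn_sorted.
Qed.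

Lemma mem_bits m k : (k \in bits m) = odd (iter k half m).
Proof.
rewrite mem_filter mem_rev mem_iota /= add0n.
case b: (odd _) => //=.
have pos : 0 < iter k half m by case: (iter k half m) b.
(* A digit at [k] forces [k < 2 ^ k <= m], so the range [k < m] loses nothing. *)
suff : 2 ^ k * iter k half m <= m.
  by apply: leq_trans; rewrite (leq_trans (ltn_expl k (ltnSn 1)))// leq_pmulr.
elim: k {b pos} => [|k IH]; first by rewrite mul1n.
apply: leq_trans IH; rewrite iterS expnSr -mulnA leq_mul2l.
by rewrite mul2n -{2}(odd_double_half (iter k half m)) leq_addl orbT.
Qed.

(** Built digit by digit: the digit at 0 is prepended to a number realizing the
    shifted set. *)
Lemma exists_bits (s : seq nat) : exists m, bits m =i s.
Proof.
suff H n (P : pred nat) : exists m, forall k, odd (iter k half m) = (k < n) && P k.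
  have [m mP] := H (\max_(x <- s) x).+1 (mem s); exists m => k.
  rewrite mem_bits mP ltnS /=; case ks: (k \in s); last by rewrite andbF.
  by rewrite leq_bigmax_seq.
elim: n P => [|n IH] P; first exists 0 => k.
  by rewrite (_ : iter k half 0 = 0)//; elim: k => //= k ->.
have [m mP] := IH (P \o S); exists (P 0 + m.*2) => -[|k].
  by rewrite /= oddD odd_double addbF oddb.
by rewrite iterSr half_bit_double mP.
Qed.

(** * Recursive representations of the cylinder algebra *)

Lemma ord_lt_irr (xi : order_space) : irreflexive (ord_lt xi).
Proof. by move=> x; rewrite /ord_lt /lt_of insubF//= eqxx. Qed.

Lemma ord_lt_trans (xi : order_space) : transitive (ord_lt xi).
Proof. by case: (set_valP xi). Qed.

Lemma ord_lt_total (xi : order_space) x y :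
  x != y -> ord_lt xi x y || ord_lt xi y x.
Proof. by case: (set_valP xi) => _; exact. Qed.

Lemma ord_ltNge (xi : order_space) x y :
  x != y -> ord_lt xi y x = ~~ ord_lt xi x y.
Proof.
move=> /(ord_lt_total xi); case yx: (ord_lt xi y x); case xy: (ord_lt xi x y) => //.
by have := ord_lt_trans xy yx; rewrite ord_lt_irr.
Qed.

Definition literal_sat (xi : order_space) (d : literal) : bool :=
  pairwise (ord_lt xi) (val d.1) == d.2.

Lemma conjunction_setE (c : seq literal) :
  \big[setI/setT]_(d <- c) literal_set d = [set xi | all (literal_sat xi) c].
Proof.
elim: c => [|d c IH]; first by rewrite big_nil; apply/seteqP; split.
rewrite big_cons IH /literal_set /cylinder /literal_sat.
apply/seteqP; split=> xi /=; case: d => l [] /=.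
- by move=> [-> ->].
- by move=> [/negP/negbTE -> ->].
- by move=> /andP[/eqP -> ->].
- by move=> /andP[/eqP -> ->]; split.
Qed.

Lemma expression_setE (e : expression) :
  expression_set e = [set xi | has (all (literal_sat xi)) e].
Proof.
rewrite /expression_set; elim: e => [|c e IH].
  by rewrite big_nil; apply/seteqP; split.
rewrite big_cons IH conjunction_setE; apply/seteqP; split=> xi /=.
  by case=> ->; rewrite ?orbT.
by case/orP; [left|right].
Qed.

Lemma expression_set_algebra (e : expression) :
  cylinder_algebra (expression_set e).
Proof.
move=> G [[GT GU GC] Gcyl].
have GI A B : G A -> G B -> G (A `&` B).
  by move=> GA GB; rewrite -[_ `&` _]setCK setCI; apply: (GC); apply: GU; exact: GC.
apply: big_ind => // [|c _]; first by rewrite -setCT; exact: GC.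
apply: big_ind => // d _; rewrite /literal_set.
by case: ifP => _; [|apply: GC]; apply: Gcyl; exists d.1.
Qed.

Lemma bits_uniq m : uniq (bits m).
Proof. by rewrite filter_uniq // rev_uniq iota_uniq. Qed.

(** The enumeration of expressions: at each of the three levels an index is read
    by [bits], the digits of a literal giving the points of its cylinder. *)
Definition nth_order (m : nat) : fin_order := exist _ (bits m) (bits_uniq m).

Definition nth_literal (k : nat) : literal := (nth_order k./2, odd k).

Definition nth_conjunction (k : nat) : seq literal := map nth_literal (bits k).

Definition nth_expression (k : nat) : expression :=
  map nth_conjunction (bits k).

Lemma recursive_nth_expression :
  recursive1 (fun i => expression_code (nth_expression i)).
Proof.
have rm := recursive_head 0.
have rl : recursive1 (fun k => literal_code (nth_literal k)).
  apply: (@recursive_code_cons 1 (fun t => odd (tnth t ord0))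
    (fun t => bits (tnth t ord0)./2)).
    exact: recursive_odd rm.
  apply: (recursive_app1 (f := fun k => CodeSeq.code (bits k)) _
    (recursive_half rm)).
  rewrite (_ : (fun k => _) = fun k => CodeSeq.code (map id (bits k))).
    exact: recursive_code_bits rm.
  by apply/funext => k; rewrite map_id.
apply: eq_recursive (recursive_code_bits (recursive_code_bits rl)) => t.
rewrite /expression_code /nth_expression -map_comp; congr CodeSeq.code.
by apply: eq_map => k /=; rewrite -map_comp.
Qed.

(** The intermediate class between expressions and indices, closed under Boolean
    operations by list manipulations. *)
Definition dnf (s : seq (seq nat)) : set order_space :=
  [set xi | has (all (fun k => literal_sat xi (nth_literal k))) s].

(** Reading indices through [bits] forgets order and repetitions in the lists,
    which the set does not see. *)
Lemma dnf_nth_expression s :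
  exists i, dnf s = expression_set (nth_expression i).
Proof.
suff [js jsE] : exists js, dnf s = dnf (map bits js).
  have [i iE] := exists_bits js; exists i.
  rewrite jsE expression_setE; apply/seteqP.
  by split=> xi /=; rewrite /dnf /= /nth_expression !has_map (eq_has_r iE);
    congr is_true; apply: eq_has => j /=; rewrite all_map.
elim: s => [|c s [js jsE]]; first by exists [::].
have [j jE] := exists_bits c; exists (j :: js).
have sE xi : has (all (fun k => literal_sat xi (nth_literal k))) s =
             has (all (fun k => literal_sat xi (nth_literal k))) (map bits js).
  by apply/idP/idP; have /seteqP[H1 H2] := jsE; [exact: H1|exact: H2].
by apply/seteqP; split=> xi /=; rewrite /dnf /= sE (eq_all_r jE).
Qed.

Lemma dnf_setU s t : dnf s `|` dnf t = dnf (s ++ t).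
Proof.
apply/seteqP; split=> xi; rewrite /dnf /= has_cat.
  by case=> ->; rewrite ?orbT.
by case/orP; [left|right].
Qed.

Lemma dnf_setI s t : dnf s `&` dnf t = dnf [seq c ++ d | c <- s, d <- t].
Proof.
apply/seteqP; split=> xi; rewrite /dnf /=.
  move=> [/hasP[c cs ac] /hasP[d dt ad]]; apply/hasP; exists (c ++ d).
    exact: allpairs_f.
  by rewrite all_cat ac.
case/hasP => _ /allpairsP[[c d] [/= cs dt ->]]; rewrite all_cat => /andP[ac ad].
by split; apply/hasP; [exists c|exists d].
Qed.

(** The parity of an index is the sign of its literal. *)
Lemma nth_literalN k : exists k', forall xi,
  literal_sat xi (nth_literal k') = ~~ literal_sat xi (nth_literal k).
Proof.
exists (~~ odd k + k./2.*2) => xi; rewrite /literal_sat /nth_literal /=.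
by rewrite half_bit_double oddD odd_double addbF oddb; case: pairwise; case: odd.
Qed.

(** De Morgan: a negated conjunction is a disjunction of one-literal
    conjunctions, and the intersection of these over the disjuncts is put back
    in normal form by distributivity. *)
Lemma dnf_setC s : exists t, ~` dnf s = dnf t.
Proof.
elim: s => [|c s [t tE]].
  by exists [:: [::]]; apply/seteqP; split=> xi.
have [u uE] : exists u, ~` dnf [:: c] = dnf u.
  elim: c => [|k c [u uE]]; first by exists [::]; apply/seteqP; split=> // xi; case.
  have [k' k'E] := nth_literalN k; exists ([:: k'] :: u).
  rewrite -(cat1s [:: k']) -dnf_setU -uE.
  apply/seteqP; split=> xi; rewrite /dnf /= k'E.
    by rewrite !orbF andbT => /negP; rewrite negb_and => /orP[->|/negP]; [left|right].
  by rewrite !orbF andbT => -[/negP H /andP[]|H /andP[]].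
exists [seq c1 ++ d | c1 <- u, d <- t].
by rewrite -(cat1s c) -dnf_setU setCU uE tE dnf_setI.
Qed.

(** The enumerated cylinders list their points in decreasing numerical order, so
    the condition that [x] precedes [y] is a positive literal if [x > y] as
    numbers, and otherwise the negation of the literal for the reversed pair. *)
Lemma dnf_lt x y : x != y -> exists s, [set xi | ord_lt xi x y] = dnf s.
Proof.
have bitsE a b : a < b -> exists m, bits m = [:: b; a].
  move=> ab; have [m mE] := exists_bits [:: b; a]; exists m.
  apply: (irr_sorted_eq _ _ (bits_sorted m) _ mE); last by rewrite /= ab.
    by move=> ? ? ? /= h1 h2; exact: ltn_trans h2 h1.
  by move=> z; rewrite /= ltnn.
move=> xy; case: (ltngtP x y) (xy) => // [xy'|yx] _.
  have [m mE] := bitsE _ _ xy'; exists [:: [:: m.*2]].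
  apply/seteqP; split=> xi; rewrite /dnf /= /literal_sat /nth_literal /=;
    by rewrite half_double odd_double mE /= !andbT orbF eqbF_neg -ord_ltNge // eq_sym.
have [m mE] := bitsE _ _ yx; exists [:: [:: m.*2.+1]].
apply/seteqP; split=> xi; rewrite /dnf /= /literal_sat /nth_literal /=;
  by rewrite uphalf_double odd_double mE /= !andbT orbF eqb_id.
Qed.

(** A cylinder is the conjunction of the comparisons between its points. *)
Lemma dnf_cylinder (l : fin_order) : exists s, cylinder l = dnf s.
Proof.
case: l => l ul; rewrite /cylinder /=.
elim: l ul => [_|x l IH /= /andP[xl ul]].
  by exists [:: [::]]; apply/seteqP; split.
have [s sE] := IH ul.
have [t tE] : exists t, [set xi | all (ord_lt xi x) l] = dnf t.
  elim: {IH ul sE} l xl => [_|y l IH]; first by exists [:: [::]]; apply/seteqP; split.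
  rewrite inE negb_or => /andP[xy xl].
  have [t tE] := IH xl; have [u uE] := dnf_lt xy.
  exists [seq c ++ d | c <- u, d <- t]; rewrite -dnf_setI -uE -tE.
  by apply/seteqP; split=> xi /=; [move=> /andP|move=> [-> ->]].
exists [seq c ++ d | c <- t, d <- s]; rewrite -dnf_setI -tE -sE.
by apply/seteqP; split=> xi /=; [move=> /andP|move=> [-> ->]].
Qed.

Lemma cylinder_algebra_nth_expression A :
  cylinder_algebra A -> exists i, A = expression_set (nth_expression i).
Proof.
suff H : cylinder_algebra `<=` range dnf.
  by move=> /H[s _ <-]; exact: dnf_nth_expression.
apply: smallest_sub.
  split.
  - by exists [:: [::]] => //; apply/seteqP; split.
  - by move=> _ _ [s _ <-] [t _ <-]; exists (s ++ t) => //; rewrite dnf_setU.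
  - by move=> _ [s _ <-]; have [t tE] := dnf_setC s; exists t.
by move=> _ [l _ <-]; have [s sE] := dnf_cylinder l; exists s.
Qed.

(** A test only has to provide recursively coded expressions: interleaving them
    with the enumeration of all expressions gives a representation of the whole
    algebra in which they sit at the even indices. *)
Lemma recursive_representation_extend (u : nat -> expression) :
  recursive1 (fun i => expression_code (u i)) ->
  exists2 T, recursive_representation T & forall i, T i.*2 = expression_set (u i).
Proof.
move=> ru; have rm := recursive_head 0.
pose e i := if odd i == 0 :> nat then u i./2 else nth_expression i./2.
exists (fun i => expression_set (e i)); last first.
  by move=> i; rewrite /e odd_double half_double.
split.
  apply/seteqP; split=> [_ [i _ <-]|A]; first exact: expression_set_algebra.
  move=> /cylinder_algebra_nth_expression[i ->]; exists i.*2.+1 => //.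
  by rewrite /e /= odd_double uphalf_double.
exists e; split=> //.
have := recursive_if (recursive_odd rm)
  (recursive_app1 (f := fun i => expression_code (u i)) ru (recursive_half rm))
  (recursive_app1 recursive_nth_expression (recursive_half rm)).
by apply: eq_recursive => t; rewrite /e; case: ifP.
Qed.

(** * Countable dense orders without endpoints *)

Definition above {T} (r : rel T) (p : option T) (x : T) : bool :=
  oapp (fun a => r a x) true p.

(** Reading [None] as an end of the order, density and the absence of endpoints
    are the same condition: no point has an immediate neighbour, neither a
    point nor an end. *)
Definition gapless {T} (r : rel T) :=
  forall p b, above r p b -> exists y, above r p y && r y b.

Record dense_order (T : eqType) (r : rel T) : Prop := DenseOrder {
  dense_irr : irreflexive r;
  dense_trans : transitive r;
  dense_total : forall x y, x != y -> r x y || r y x;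
  dense_below : gapless r;
  dense_above : gapless (fun x y => r y x)
}.

Lemma dense_order_flip (T : eqType) (r : rel T) :
  dense_order r -> dense_order (fun x y => r y x).
Proof.
case=> ir tr tot db da; split=> //.
- by move=> y x z xy yz; exact: tr yz xy.
- by move=> x y xy; rewrite orbC tot.
Qed.

(** A finite set has a largest element; [None] covers the empty set, so that the
    gapless condition applies to the result in all cases. *)
Lemma exists_upper (T : eqType) (r : rel T) (L : seq T) : dense_order r ->
  exists2 p, (forall z, above r p z = all (r^~ z) L) &
             (forall a, p = Some a -> a \in L).
Proof.
move=> dr; elim: L => [|x L [p pE pL]]; first by exists None.
case: p pE pL => [a|] pE pL; last by exists (Some x) => [z|_ [<-]];
  [rewrite /= -pE andbT|rewrite inE eqxx].
have aL := pL _ erefl.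
case: (eqVneq x a) => [xa|/(dense_total dr)/orP[xa|ax]].
- exists (Some a) => [z|_ [<-]]; last by rewrite inE aL orbT.
  by rewrite /= -pE xa /= andbb.
- exists (Some a) => [z|_ [<-]]; last by rewrite inE aL orbT.
  rewrite /= -pE /=; case az: (r a z); last by rewrite andbF.
  by rewrite (dense_trans dr xa az).
- exists (Some x) => [z|_ [<-]]; last by rewrite inE eqxx.
  rewrite /= -pE /=; case xz: (r x z) => //=.
  by rewrite (dense_trans dr ax xz).
Qed.

(** The extension property behind the back-and-forth construction: it reduces to
    the gap between the largest point of [L] and the smallest point of [U].  The
    point [x0] answers the case of [L] and [U] both empty. *)
Lemma dense_between (T : eqType) (r : rel T) (x0 : T) (L U : seq T) :
  dense_order r -> {in L & U, forall x y, r x y} ->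
  exists z, all (r^~ z) L && all (r z) U.
Proof.
move=> dr LU.
have [p pE pL] := exists_upper L dr.
have [q qE qU] := exists_upper U (dense_order_flip dr).
case: q qE qU => [u|] qE qU.
  have pu : above r p u by rewrite pE; apply/allP => x xL; apply: LU => //; exact: qU.
  have [y /andP[py yu]] := dense_below dr pu.
  by exists y; rewrite -pE py -qE.
case: p pE pL => [l|] pE pL; last by exists x0; rewrite -pE -qE.
have [y ly] := dense_above dr (p := None) (b := l) isT.
by exists y; rewrite -pE -qE /= andbT.
Qed.

Definition partial_iso (A B : eqType) (r : rel A) (s : rel B) (p : seq (A * B)) :=
  {in p &, forall u v, r u.1 v.1 = s u.2 v.2}.

(** The image of a new point is chosen between the images of the points below and
    above it. *)
Lemma partial_iso_extend (A B : eqType) (r : rel A) (s : rel B) (b0 : B)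
    (p : seq (A * B)) (a : A) :
  dense_order r -> dense_order s -> partial_iso r s p ->
  exists p', [/\ partial_iso r s p', {subset p <= p'} & a \in map fst p'].
Proof.
move=> dr ds pp; case: (boolP (a \in map fst p)) => [ap|ap].
  by exists p; split.
have [b /andP[/allP bL /allP bU]] : exists b,
    all (s^~ b) [seq u.2 | u <- p & r u.1 a] &&
    all (s b) [seq u.2 | u <- p & r a u.1].
  apply: dense_between => // x y /mapP[u + ->] /mapP[v + ->].
  rewrite !mem_filter => /andP[ua up] /andP[av vp].
  by rewrite -pp // (dense_trans dr ua av).
have sN x y : s x y -> s y x = false.
  by move=> xy; apply/negP => yx; have := dense_trans ds xy yx; rewrite dense_irr.
have rN x y : r x y -> r y x = false.
  by move=> xy; apply/negP => yx; have := dense_trans dr xy yx; rewrite dense_irr.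
have H u : u \in p -> r u.1 a = s u.2 b /\ r a u.1 = s b u.2.
  move=> up; have ua : u.1 != a by apply: contraNneq ap => <-; exact: map_f.
  case/orP: (dense_total dr ua) => [lt|lt].
    have sub : s u.2 b by apply: bL; apply: map_f; rewrite mem_filter lt.
    by rewrite lt sub (rN _ _ lt) (sN _ _ sub).
  have sbu : s b u.2 by apply: bU; apply: map_f; rewrite mem_filter lt.
  by rewrite lt sbu (rN _ _ lt) (sN _ _ sbu).
exists ((a, b) :: p); split=> [u v|u up|]; last by rewrite inE eqxx.
- rewrite !inE => /orP[/eqP->|up] /orP[/eqP->|vp] /=.
  + by rewrite !dense_irr.
  + by case: (H v vp).
  + by case: (H u up).
  + exact: pp.
- by rewrite inE up orbT.
Qed.

Lemma partial_iso_swap (A B : eqType) (r : rel A) (s : rel B) p :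
  partial_iso r s p -> partial_iso s r [seq (u.2, u.1) | u <- p].
Proof. by move=> pp _ _ /mapP[u up ->] /mapP[v vp ->] /=; rewrite pp. Qed.

Lemma partial_iso_back_forth (A B : eqType) (r : rel A) (s : rel B)
    (p : seq (A * B)) (a : A) (b : B) :
  dense_order r -> dense_order s -> partial_iso r s p ->
  exists p', [/\ partial_iso r s p', {subset p <= p'}, a \in map fst p' &
                 b \in map snd p'].
Proof.
move=> dr ds pp.
have [p1 [pp1 s1 ap1]] := partial_iso_extend b a dr ds pp.
have [p2 [pp2 s2 bp2]] := partial_iso_extend a b ds dr (partial_iso_swap pp1).
have sub u : u \in p1 -> u \in [seq (u.2, u.1) | u <- p2].
  move=> up; apply/mapP; exists (u.2, u.1); last by case: u up.
  by apply: s2; apply/mapP; exists u.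
exists [seq (u.2, u.1) | u <- p2]; split.
- exact: partial_iso_swap.
- by move=> u /s1/sub.
- by case/mapP: ap1 => u /sub up ->; exact: map_f.
- by rewrite -map_comp.
Qed.

(** Cantor: going back and forth along enumerations of the two sides, the union
    of an increasing chain of finite partial isomorphisms is an isomorphism. *)
Lemma cantor_iso (A B : countType) (r : rel A) (s : rel B) (a0 : A) (b0 : B) :
  dense_order r -> dense_order s ->
  exists2 f : A -> B, bijective f & forall x y, r x y = s (f x) (f y).
Proof.
move=> dr ds.
pose X := {p : seq (A * B) | partial_iso r s p}.
have stepP (p : X) (ab : A * B) : exists p' : X,
    [/\ {subset sval p <= sval p'}, ab.1 \in map fst (sval p') &
        ab.2 \in map snd (sval p')].
  have [p' [pp' sub ap bp]] := partial_iso_back_forth ab.1 ab.2 dr ds (svalP p).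
  by exists (exist _ p' pp').
pose step p ab := sval (cid (stepP p ab)).
have p0 : partial_iso r s [::] by [].
(* Stage [m] takes care of the points numbered [m] on both sides. *)
pose chain := fix chain n : X := if n is m.+1 then
  step (chain m) (odflt a0 (unpickle m), odflt b0 (unpickle m)) else exist _ [::] p0.
have chainS n : {subset sval (chain n) <= sval (chain n.+1)}.
  by rewrite /= /step; case: cid => p' [].
have chain_le m n : m <= n -> {subset sval (chain m) <= sval (chain n)}.
  move=> /subnK <-; elim: (n - m) => // k IH u /IH; exact: chainS.
have chain_iso m n u v : u \in sval (chain m) -> v \in sval (chain n) ->
    r u.1 v.1 = s u.2 v.2.
  move=> um vn; apply: (svalP (chain (maxn m n))).
    by apply: chain_le um; exact: leq_maxl.
  by apply: chain_le vn; exact: leq_maxr.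
have fP a : exists b, exists n, (a, b) \in sval (chain n).
  have : a \in map fst (sval (chain (pickle a).+1)).
    by rewrite /= /step; case: cid => p' []; rewrite pickleK.
  by case/mapP => -[a' b] H /= ->; exists b, (pickle a).+1.
have gP b : exists a, exists n, (a, b) \in sval (chain n).
  have : b \in map snd (sval (chain (pickle b).+1)).
    by rewrite /= /step; case: cid => p' []; rewrite pickleK.
  by case/mapP => -[a b'] H /= ->; exists a, (pickle b).+1.
pose f a := sval (cid (fP a)); pose g b := sval (cid (gP b)).
have fP' a : exists n, (a, f a) \in sval (chain n) by rewrite /f; case: cid.
have gP' b : exists n, (g b, b) \in sval (chain n) by rewrite /g; case: cid.
exists f; last first.
  by move=> x y; have [m xm] := fP' x; have [n yn] := fP' y; exact: chain_iso xm yn.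
exists g => [a|b].
  have [m am] := fP' a; have [n an] := gP' (f a).
  apply/eqP/negPn/negP => /(dense_total dr).
  have /= -> := chain_iso _ _ _ _ an am; have /= -> := chain_iso _ _ _ _ am an.
  by rewrite !(dense_irr ds).
have [m am] := gP' b; have [n an] := fP' (g b).
apply/eqP/negPn/negP => /(dense_total ds).
have /= <- := chain_iso _ _ _ _ an am; have /= <- := chain_iso _ _ _ _ am an.
by rewrite !(dense_irr dr).
Qed.

Lemma rat_dense_order : dense_order (fun x y : rat => (x < y)%R).
Proof.
split.
- exact: ltxx.
- exact: lt_trans.
- by move=> x y; rewrite neq_lt.
- move=> [a|] b /= ab; last by exists (b - 1)%R; rewrite ltrBlDr ltrDl.
  by exists ((a + b) / 2)%R; rewrite midf_lt// midf_lt.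
- move=> [a|] b /= ab; last by exists (b + 1)%R; rewrite ltrDl.
  by exists ((b + a) / 2)%R; rewrite !midf_lt.
Qed.

(** * Gaps and their measure *)

(** Comparing two points depends on one coordinate of the product space. *)
Lemma measurable_ord_lt x y :
  measurable ([set xi | ord_lt xi x y] : set order_borel).
Proof.
apply: sub_gen_smallest.
have H : open [set xi : offdiag_space | lt_of xi x y].
  rewrite /lt_of; case: insubP => [p _ _|_] /=; last first.
    by rewrite (_ : [set _ | _] = set0); [exact: open0|apply/seteqP; split].
  have C : continuous (proj p : offdiag_space -> bool).
    exact: proj_continuous.
  exact: (open_comp (fun xi _ => C xi) (discrete_open [set true])).
have C : continuous (@set_val _ total_orders : order_space -> offdiag_space).
  exact: initial_continuous.
exact: (open_comp (fun xi _ => C xi) H).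
Qed.

Definition dir (v : bool) (xi : order_space) : rel nat :=
  fun x y => if v then ord_lt xi x y else ord_lt xi y x.

(** The direction [v] lets one argument serve for predecessors and successors,
    and [p = None] for the ends of the order.  With [P] finite this is the event
    whose probability is computed by symmetry; with [P] everything it is a gap. *)
Definition nearest (v : bool) (p : option nat) (P : pred nat) (b : nat) :
    set order_borel :=
  [set xi | above (dir v xi) p b /\
            forall y, P y -> ~~ (above (dir v xi) p y && dir v xi y b)].

Definition gap (v : bool) (p : option nat) (b : nat) : set order_borel :=
  nearest v p predT b.

Lemma measurable_dir v x y :
  measurable ([set xi | dir v xi x y] : set order_borel).
Proof. by case: v; exact: measurable_ord_lt. Qed.

Lemma measurable_above v p b :
  measurable ([set xi | above (dir v xi) p b] : set order_borel).
Proof.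
case: p => [a|]; first exact: measurable_dir.
rewrite (_ : [set _ | _] = setT); first exact: measurableT.
by apply/seteqP; split.
Qed.

Lemma measurable_nearest v p P b : measurable (nearest v p P b).
Proof.
have -> : nearest v p P b = [set xi | above (dir v xi) p b] `&`
    \bigcap_(y in setT) (if P y then ~` ([set xi | above (dir v xi) p y] `&`
       [set xi | dir v xi y b]) else setT).
  apply/seteqP; split=> xi /= [pb H]; split=> // y.
    by move=> _; case: ifP => // /H /negP H' [] py yb; apply: H'; rewrite py.
  by move=> Py; apply/negP => /andP[py yb]; have := H y I; rewrite Py; apply.
apply: measurableI; first exact: measurable_above.
apply: bigcapT_measurable => y; case: ifP => _; last exact: measurableT.
by apply: measurableC; apply: measurableI;
  [exact: measurable_above|exact: measurable_dir].
Qed.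

Lemma dir_act s v xi x y :
  dir v (act s xi) x y = dir v xi (perm_inv s x) (perm_inv s y).
Proof.
rewrite /dir /ord_lt /=.
have E a b : lt_of (set_val (act s xi)) a b = act_rel s xi a b.
  by rewrite /= lt_of_restr_rel // => z; exact: ord_lt_irr.
by case: v; rewrite E.
Qed.

Lemma dir_irr v xi : irreflexive (dir v xi).
Proof. by case: v => x; rewrite /dir ord_lt_irr. Qed.

Lemma dir_total v xi x y : x != y -> dir v xi x y || dir v xi y x.
Proof. by move=> /(ord_lt_total xi); case: v => //=; rewrite orbC. Qed.

Definition swap_fun (b z x : nat) : nat :=
  if x == b then z else if x == z then b else x.

Lemma swap_funK b z : involutive (swap_fun b z).
Proof.
move=> x; rewrite /swap_fun; case: (eqVneq x b) => [->|xb].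
  by case: (eqVneq z b) => [//|_]; rewrite eqxx.
by case: (eqVneq x z) => [->|xz]; rewrite ?eqxx // (negbTE xb) (negbTE xz).
Qed.

Definition swap_perm b z := PermNat (swap_funK b z) (swap_funK b z).

(** The points of [s] are exchangeable by permutations fixing [p], so each is
    nearest above [p] with the same probability; and two distinct points cannot
    both be nearest. *)
Lemma nearest_measure (R : realType) (mu : probability order_borel R)
    (v : bool) (p : option nat) (s : seq nat) (b : nat) :
  glasner_weiss mu -> uniq s -> b \in s ->
  (forall a, p = Some a -> a \notin s) ->
  ((size s)%:R%:E * mu (nearest v p (mem s) b) <= 1)%E.
Proof.
move=> hmu us bs ps.
have muE z : z \in s -> mu (nearest v p (mem s) z) = mu (nearest v p (mem s) b).
  move=> zs; rewrite -[RHS](hmu (swap_perm b z)); last exact: measurable_nearest.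
  congr (mu _).
  have ms x : swap_fun b z x \in s = (x \in s).
    rewrite /swap_fun; case: eqVneq => [->|_]; first by rewrite zs bs.
    by case: eqVneq => [->|//]; rewrite zs bs.
  have aE xi x : above (dir v (act (swap_perm b z) xi)) p x =
                 above (dir v xi) p (swap_fun b z x).
    case: p ps => //= a /(_ _ erefl) as_; rewrite dir_act /=; congr dir.
    by rewrite /swap_fun !ifN_eq //; apply: contraNneq as_ => ->.
  have sb : swap_fun b z b = z by rewrite /swap_fun eqxx.
  apply/seteqP; split=> xi /=; rewrite /nearest /= aE sb => -[pz H]; split=> // y ys.
    by rewrite aE dir_act /= sb; apply: H; rewrite /= ms.
  have := H (swap_fun b z y); rewrite aE dir_act /= swap_funK sb.
  by rewrite ms; apply.
(* Of two points nearest above [p], the smaller one would lie in between. *)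
have tr : trivIset [set` s] (nearest v p (mem s)).
  move=> x y /= xs ys [xi [[px Hx] [py Hy]]]; apply/eqP/negPn/negP => /(dir_total v xi).
  by have := Hx y ys; have := Hy x xs; rewrite px py /= => /negbTE-> /negbTE->.
have me z : [set` s] z -> measurable (nearest v p (mem s) z).
  by move=> _; exact: measurable_nearest.
have /= E := measure_fin_bigcup mu (finite_seq s) tr me.
have : (mu (\bigcup_(z in [set` s]) nearest v p (mem s) z) <= 1)%E.
  apply: probability_le1; apply: fin_bigcup_measurable me; exact: finite_seq.
rewrite {}E -fsbig_seq // big_seq (eq_bigr _ muE) -big_seq.
rewrite big_const_seq count_predT.
have fin : mu (nearest v p (mem s) b) \is a fin_num.
  by apply: fin_num_measure; exact: measurable_nearest.
rewrite -(fineK fin) -EFinM mulr_natl.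
suff -> n (x : R) : iter n (GRing.add x%:E) 0%R = (x *+ n)%:E by [].
by elim: n => //= n ->; rewrite mulrS.
Qed.

(** Removing duplicates gives every list a value, so that no proof of distinctness
    enters the expressions of the tests. *)
Definition order_of (l : seq nat) : fin_order := exist _ (undup l) (undup_uniq l).

Definition gap_seq (p : option nat) (ys : seq nat) (b : nat) : seq nat :=
  oapp (cons^~ [::]) [::] p ++ ys ++ [:: b].

Definition gap_order (v : bool) (p : option nat) (ys : seq nat) (b : nat) : fin_order :=
  order_of (if v then gap_seq p ys b else rev (gap_seq p ys b)).

Definition gap_bound (p : option nat) (b : nat) : nat := (maxn (odflt 0 p) b).+1.

Lemma gap_bound_fresh p b y :
  gap_bound p b <= y -> p <> Some y /\ y != b.
Proof.
rewrite gtn_max => /andP[py yb]; split; last by rewrite neq_ltn yb orbT.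
by move=> pE; move: py; rewrite pE /= ltnn.
Qed.

Lemma gap_seq_uniq1 p b : p <> Some b -> uniq (gap_seq p [::] b).
Proof.
by case: p => //= a ab; rewrite inE andbT; apply/eqP => e; apply: ab; rewrite e.
Qed.

Lemma gap_seq_uniq2 p b y :
  p <> Some b -> p <> Some y -> y != b -> uniq (gap_seq p [:: y] b).
Proof.
case: p => [a|] /= ab ay yb; rewrite ?inE yb //= !andbT negb_or.
by apply/andP; split; apply/eqP => e; [apply: ay|apply: ab]; rewrite e.
Qed.

Lemma val_gap_order v p ys b : uniq (gap_seq p ys b) ->
  val (gap_order v p ys b) =
  if v then gap_seq p ys b else rev (gap_seq p ys b).
Proof. by move=> u; rewrite /= undup_id //; case: v => //; rewrite rev_uniq. Qed.

(** Approximations to a gap, on [n] points beyond [p] and [b].  Their order is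
    reversed so that passing to [n.+1] puts one literal in front, as a primitive
    recursion on codes of lists does. *)
Definition gap_test v p b (n : nat) : expression :=
  [:: [seq (gap_order v p [:: gap_bound p b + j] b, false) | j <- rev (iota 0 n)] ++
      [:: (gap_order v p [::] b, true)]].

Lemma gap_order_sat1 v p b xi : p <> Some b ->
  pairwise (ord_lt xi) (val (gap_order v p [::] b)) = above (dir v xi) p b.
Proof.
move=> pb; rewrite val_gap_order ?gap_seq_uniq1 //.
by case: p {pb} => [a|]; case: v => //=; rewrite !andbT.
Qed.

Lemma gap_order_sat2 v p b y xi : p <> Some b -> p <> Some y -> y != b ->
  pairwise (ord_lt xi) (val (gap_order v p [:: y] b)) =
  above (dir v xi) p y && dir v xi y b.
Proof.
move=> pb py yb; rewrite val_gap_order ?gap_seq_uniq2 //.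
case: p {pb py} => [a|]; case: v => /=; rewrite ?andbT //.
- case: (boolP (ord_lt xi a y)) => h; rewrite ?andbF //=.
  by case: (boolP (ord_lt xi y b)) => h'; rewrite ?andbF //= (ord_lt_trans h h').
- case: (boolP (ord_lt xi b y)) => h; rewrite ?andbF //= andbT.
  by case: (boolP (ord_lt xi y a)) => h'; rewrite ?andbF // (ord_lt_trans h h').
Qed.

Lemma gap_test_set v p b n : p <> Some b ->
  expression_set (gap_test v p b n) =
  nearest v p (mem (b :: iota (gap_bound p b) n)) b.
Proof.
move=> pb; set c := gap_bound p b.
have satE xi : has (all (literal_sat xi)) (gap_test v p b n) =
   all (fun j => ~~ (above (dir v xi) p (c + j) && dir v xi (c + j) b)) (iota 0 n)
   && above (dir v xi) p b.
  rewrite /gap_test [LHS]/= orbF all_cat all_map all_rev [all _ [:: _]]/= andbT.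
  congr andb.
    apply: eq_all => j; rewrite [LHS]/= /literal_sat eqbF_neg.
    have [py yb] := gap_bound_fresh (leq_addr j (gap_bound p b)).
    by rewrite gap_order_sat2.
  by rewrite /literal_sat eqb_id gap_order_sat1.
rewrite expression_setE (funext (fun xi => congr1 is_true (satE xi))).
apply/seteqP; split=> xi /=; rewrite /nearest /=.
  move=> /andP[/allP H ->]; split=> // y; rewrite inE => /orP[/eqP->|].
    by rewrite dir_irr andbF.
  rewrite mem_iota => /andP[cy yn]; rewrite -(subnKC cy); apply: H.
  by rewrite mem_iota /= add0n ltn_subLR.
move=> [-> H]; rewrite andbT; apply/allP => j; rewrite mem_iota add0n /= => jn.
by apply: H; rewrite inE mem_iota leq_addr ltn_add2l jn orbT.
Qed.

Lemma recursive_gap_test v p b : p <> Some b ->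
  recursive1 (fun n => expression_code (gap_test v p b n)).
Proof.
move=> pb; set c := gap_bound p b.
have lE j : literal_code (gap_order v p [:: c + j] b, false) = CodeSeq.code
   (0 :: if v then gap_seq p [:: c + j] b else rev (gap_seq p [:: c + j] b)).
  have [py yb] := gap_bound_fresh (leq_addr j (gap_bound p b)).
  by rewrite /literal_code val_gap_order // gap_seq_uniq2.
have rl : recursive1 (fun j => literal_code (gap_order v p [:: c + j] b, false)).
  have rc := recursive_cst 1; have rj := recursive_add (rc c) (recursive_head 0).
  rewrite (funext lE) /recursive1.
  have rb : recursive (fun _ : 1.-tuple nat => CodeSeq.code [:: b]) by exact: rc.
  have r0 : recursive (fun _ : 1.-tuple nat => CodeSeq.code [::]) by exact: rc.
  case: (p) => [a|]; case: v {lE}; apply: (recursive_code_cons (rc 0)) => /=.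
  - exact: recursive_code_cons (rc a) (recursive_code_cons rj rb).
  - exact: recursive_code_cons (rc b) (recursive_code_cons rj (rc (CodeSeq.code [:: a]))).
  - exact: recursive_code_cons rj rb.
  - exact: recursive_code_cons (rc b) (recursive_code_cons rj r0).
pose l0 := [:: (gap_order v p [::] b, true)].
pose l j : literal := (gap_order v p [:: c + j] b, false).
have rconj : recursive1 (fun n => CodeSeq.code
    (map literal_code ([seq l j | j <- rev (iota 0 n)] ++ l0))).
  have := recursive_nat_rect
    (h := fun j r _ => 2 ^ literal_code (l j) * r.*2.+1) (recursive_head 0)
    (recursive_cst 1 (CodeSeq.code (map literal_code l0)))
    (recursive_mul (recursive_exp2 (recursive_app1 rl (recursive_head 2)))
       (recursive_S (recursive_double (recursive_behead (recursive_head 1))))).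
  apply: eq_recursive => t; rewrite -[tnth t ord0]/(thead t).
  elim: (thead t) => // n IH; rewrite [LHS]/= IH.
  by rewrite -[in RHS]addn1 iotaD rev_cat.
exact: (@recursive_code_cons 1 _ (fun=> [::]) rconj (recursive_cst 1 0)).
Qed.

(** * Almost all orders are dense without endpoints *)

(** Here each open set of the test is a single member of the algebra, so
    the enumeration of the test is constant along the union. *)
Lemma constructive_null_test (R : realType) (mu : probability order_borel R)
    (A : set order_space) (u : nat -> expression) (g : nat -> nat) :
  recursive1 (fun n => expression_code (u n)) -> recursive1 g ->
  (forall n, A `<=` expression_set (u n)) ->
  (forall k n, g k <= n -> (mu (expression_set (u n)) < ((2^-1 : R) ^+ k)%R%:E)%E) ->
  constructive_null mu A.
Proof.
move=> ru rg Au mu_u; have [T rT TE] := recursive_representation_extend ru.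
have cE n : \bigcup_(m in [set: nat]) T n.*2 = expression_set (u n).
  by rewrite TE; apply/seteqP; split=> [xi [? _]|xi] //; exists 0.
exists T; split=> //; exists (fun n _ => n.*2); split.
  exact: recursive_double (recursive_proj _).
split; first by move=> xi Axi n _; rewrite cE; exact: Au.
by exists g; split=> // k n; rewrite cE; exact: mu_u.
Qed.

Lemma gap_Some0 v p b : p = Some b -> gap v p b = set0.
Proof.
by move=> ->; apply/seteqP; split=> xi //; rewrite /gap /nearest /= dir_irr => -[].
Qed.

Lemma gap_sub_nearest v p P b : gap v p b `<=` nearest v p P b.
Proof. by move=> xi [pb H]; split=> // y _; exact: H. Qed.

(** The set of the test is the event that [b] is nearest above [p] among [n + 1]
    points. *)
Lemma gap_test_measure (R : realType) (mu : probability order_borel R)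
    v p b n :
  glasner_weiss mu -> p <> Some b ->
  (mu (expression_set (gap_test v p b n)) <= (n.+1%:R^-1 : R)%:E)%E.
Proof.
move=> hmu pb; rewrite gap_test_set //.
set s := b :: iota _ n; have mE := measurable_nearest v p (mem s) b.
have := @nearest_measure R mu v p s b hmu.
rewrite -(fineK (fin_num_measure mu _ mE)) -EFinM !lee_fin [size s]/= size_iota => H.
rewrite -[leRHS]mul1r ler_pdivlMr ?ltr0Sn // mulrC; apply: H.
- by rewrite /= iota_uniq andbT mem_iota negb_and -ltnNge ltnS leq_maxr.
- by rewrite inE eqxx.
- move=> a pa; rewrite inE negb_or mem_iota /gap_bound pa /= negb_and -ltnNge ltnS leq_maxl andbT.
  by apply/eqP => e; apply: pb; rewrite pa e.
Qed.

(** The modulus is [2 ^ k], as [1 / (n + 1) < 1 / 2 ^ k] for [n >= 2 ^ k]. *)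
Lemma gap_constructive_null (R : realType) (mu : probability order_borel R)
    v p b :
  glasner_weiss mu -> p <> Some b ->
  constructive_null mu (gap v p b).
Proof.
move=> hmu pb; apply: (@constructive_null_test _ _ _ (gap_test v p b) (fun k => 2 ^ k)).
- exact: recursive_gap_test.
- exact: recursive_exp2 (recursive_head 0).
- by move=> n; rewrite gap_test_set //; exact: gap_sub_nearest.
- move=> k n kn; apply: le_lt_trans (gap_test_measure v n hmu pb) _.
  rewrite lte_fin exprVn -natrX ltf_pV2 ?posrE ?ltr0n ?expn_gt0 //.
  by rewrite ltr_nat ltnS.
Qed.

(** A gap lies in its tests, whose measures are at most [1 / (n + 1)]. *)
Lemma gap_measure0 (R : realType) (mu : probability order_borel R) v p b :
  glasner_weiss mu -> mu (gap v p b) = 0%E.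
Proof.
move=> hmu.
have [->|pb] := pselect (p = Some b); first by rewrite gap_Some0 // measure0.
have mg := measurable_nearest v p predT b.
have le n : (mu (gap v p b) <= (n.+1%:R^-1 : R)%:E)%E.
  apply: le_trans (gap_test_measure v n hmu pb); rewrite gap_test_set //.
  apply: le_measure; rewrite ?inE; try exact: measurable_nearest.
  exact: gap_sub_nearest.
apply/eqP; rewrite eq_le measure_ge0 andbT.
rewrite -(fineK (fin_num_measure mu _ mg)) lee_fin leNgt; apply/negP => gt0.
have := le (Num.bound (fine (mu (gap v p b)))^-1).
rewrite -(fineK (fin_num_measure mu _ mg)) lee_fin leNgt => /negP; apply.
rewrite -[ltRHS]invrK ltf_pV2 ?posrE ?ltr0Sn ?invr_gt0 //.
apply: lt_trans (archi_boundP _) _; first by rewrite invr_ge0 ltW.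
by rewrite ltr_nat.
Qed.

(** Gaps are carried back along an isomorphism with the rationals; conversely a
    gapless order is countable, dense and without endpoints. *)
Lemma rational_orders_gapless xi :
  rational_orders xi <-> forall v p b, ~ gap v p b xi.
Proof.
split=> [[f fbij fE] v p b [pb H]|nogap].
  have [g fK gK] := fbij.
  have E x y : dir v xi x y = if v then (f x < f y)%R else (f y < f x)%R.
    by case: v {pb H}; rewrite /dir fE.
  have [q /andP[pq qb]] : exists q : rat,
      above (fun x y => if v then (x < y)%R else (y < x)%R) (omap f p) q &&
      (if v then (q < f b)%R else (f b < q)%R).
    have := if v as v0 return
      gapless (fun x y : rat => if v0 then (x < y)%R else (y < x)%R)
      then dense_below rat_dense_order else dense_above rat_dense_order.
    by apply; case: p pb {H} => //= a; rewrite E.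
  have /negP := H (g q) isT; apply; rewrite E gK qb andbT.
  by case: p pb pq {H} => //= a _; rewrite E gK.
have G v : gapless (dir v xi).
  move=> p b pb; apply: contrapT => H; apply: (nogap v p b); split=> // y _.
  by apply/negP => yb; apply: H; exists y.
have D : dense_order (ord_lt xi).
  split; [exact: ord_lt_irr|exact: ord_lt_trans|exact: ord_lt_total|
          exact: (G true)|exact: (G false)].
exact: (cantor_iso 0 0%R D rat_dense_order).
Qed.

(** There are only countably many possible gaps: this yields both measurability
    and full measure. *)
Lemma rational_ordersE :
  rational_orders = ~` \bigcup_n
    (if unpickle n is Some (v, p, b) then gap v p b else set0).
Proof.
apply/seteqP; split=> xi.
  move=> /rational_orders_gapless H [n _].
  by case: unpickle => [[[v p] b]|//] /H.
move=> H; apply/rational_orders_gapless => v p b g; apply: H.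
by exists (pickle (v, p, b)) => //; rewrite pickleK.
Qed.

Theorem theorem5 (R : realType) (mu : probability order_borel R)
    (hmu : glasner_weiss mu) :
  ML_random mu `<=` rational_orders /\
  (measurable (rational_orders : set order_borel) /\
   mu rational_orders = 1%E).
Proof.
split.
  move=> xi ML; apply/rational_orders_gapless => v p b gxi.
  have pb : p <> Some b by move=> pE; move: gxi; rewrite gap_Some0.
  exact: ML _ (gap_constructive_null v hmu pb) gxi.
pose F n : set order_borel :=
  if unpickle n is Some (v, p, b) then gap v p b else set0.
have mF n : measurable (F n).
  rewrite /F; case: unpickle => [[[v p] b]|]; last exact: measurable0.
  exact: measurable_nearest.
have mUF : measurable (\bigcup_n F n) by exact: bigcupT_measurable.
rewrite rational_ordersE; split; first exact: measurableC.
rewrite probability_setC // (measure_negligible mUF) ?sube0 //.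
apply: negligible_bigcup => n; apply/negligibleP => //.
rewrite /F; case: unpickle => [[[v p] b]|]; last exact: measure0.
exact: gap_measure0.
Qed.
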